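(* Let $n\ge 2$, let $\Omega$ be a family of $n$-ary multilinear polynomials, and let $T$ be a color $n$-ary $\Omega$-algebra over the field $F$. Let $t$ be an indeterminate and let $$\breve{T}=\Big\{\sum (x\otimes t+y\otimes t^{n}) \;\Big|\; x,y\in T\Big\}\subseteq T\otimes \big(F[t]/(t^{n+1})\big).$$ Then $\breve{T}$ is a color $n$-ary $\Omega$-algebra with the operation $$[x_1\otimes t^{i_1},x_2\otimes t^{i_2},\ldots,x_n\otimes t^{i_n}]=[x_1,x_2,\ldots,x_n]\otimes t^{i_1+\cdots+i_n},\qquad x_1,\ldots,x_n\in T,\ i_j\in\{1,n\}.$$
   Context: $F$ is a field, $G$ is an abelian group (written additively), and $\epsilon:G\times G\to F^*$ is a bicharacter, i.e. $\epsilon(f,g+h)=\epsilon(f,g)\epsilon(f,h)$, $\epsilon(g+h,f)=\epsilon(g,f)\epsilon(h,f)$, $\epsilon(g,h)\epsilon(h,g)=1$ for all $f,g,h\in G$. A color $n$-ary algebra is a $G$-graded vector space $T=\bigoplus_{g\in G}T_g$ over $F$ with an $n$-linear map $[\cdot,\ldots,\cdot]:T\times\cdots\times T\to T$ such that $[T_{\theta_1},\ldots,T_{\theta_n}]\subseteq T_{\theta_1+\cdots+\theta_n}$ for all $\theta_i\in G$. If $x\in T_g$ we write $hg(x)=g$, and $\epsilon(a,b):=\epsilon(hg(a),hg(b))$ for homogeneous $a,b$. Color polynomials: let $f$ be an ($n$-ary) multilinear polynomial in variables $x_1,\ldots,x_m$, i.e. a linear combination over $F$ of nonassociative words, formed with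 an $n$-ary bracket, each containing every variable $x_1,\ldots,x_m$ exactly once. Fix the order of variables $(x_{i_1},\ldots,x_{i_m})$ of one nonassociative word occurring in $f$ and write $f=\sum_{\beta,\,\sigma\in S_m}\alpha_{\sigma,\beta}[x_{\sigma(i_1)}\ldots x_{\sigma(i_m)}]_\beta$, where $\beta$ runs over arrangements of brackets. To an interchange of adjacent variables $\ldots x_a x_b\ldots\mapsto\ldots x_b x_a\ldots$ assign the factor $\epsilon(x_a,x_b)$; let $\epsilon_\sigma$ be the product of the factors of a sequence of such interchanges leading from the fixed order to the order $(x_{\sigma(i_1)},\ldots,x_{\sigma(i_m)})$ (equivalently, the product of $\epsilon(x_a,x_b)$ over all pairs such that $x_a$ precedes $x_b$ in the fixed order but $x_b$ precedes $x_a$ in the new order). The color polynomial of $f$ is $f_{co}=\sum_{\beta,\sigma}\alpha_{\sigma,\beta}\,\epsilon_\sigma\,[x_{\sigma(i_1)}\ldots x_{\sigma(i_m)}]_\beta$. For a family $\Omega=\{f_i\}$ of $n$-ary multilinear polynomials, a color $n$-ary $\Omega$-algebra is a color $n$-ary algebra satisfying all the identities $(f_i)_{co}=0$ upon substitution of arbitrary homogeneous elements. The grading on $\breve T$ is $\breve T_g=T_g\otimes t+T_g\otimes t^n$; powers $t^k$ with $k\ge n+1$ are zero. *)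

(* Defs.v *)
From HB Require Import structures.
From mathcomp Require Import all_boot all_order all_algebra.
From mathcomp Require Import boolp freeg.
From mathcomp Require Import sesquilinear.

Set Implicit Arguments.
Unset Strict Implicit.
Unset Printing Implicit Defensive.
Import GRing.Theory.
Local Open Scope ring_scope.

(* The nonvanishing condition makes eps a map into F^*.                       *)
Record bicharacter (F : fieldType) (G : zmodType) (eps : G -> G -> F) : Prop := {
  bichar_neq0 : forall g h, eps g h != 0;
  bicharDr : forall f g h, eps f (g + h) = eps f g * eps f h;
  bicharDl : forall f g h, eps (g + h) f = eps g f * eps h f;
  bichar_skew : forall g h, eps g h * eps h g = 1
}.

(* T is the internal direct sum of the subspaces T_ g.                        *)
Record graded (F : fieldType) (G : zmodType) (T : lmodType F)
    (T_ : G -> {pred T}) : Prop := {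
  graded_submod : forall g, submod_closed (T_ g);
  graded_span : forall x, exists (s : seq G) (c : G -> T),
    (forall g, c g \in T_ g) /\ x = \sum_(g <- s) c g;
  graded_free : forall (s : seq G) (c : G -> T), uniq s ->
    (forall g, c g \in T_ g) -> \sum_(g <- s) c g = 0 ->
    forall g, g \in s -> c g = 0
}.

Definition upd (n : nat) (T : Type) (u : {ffun 'I_n -> T}) (i : 'I_n) (x : T)
  : {ffun 'I_n -> T} := [ffun j => if j == i then x else u j].

Definition multilinear (F : fieldType) (n : nat) (T : lmodType F)
    (br : {ffun 'I_n -> T} -> T) : Prop :=
  forall (u : {ffun 'I_n -> T}) (i : 'I_n) (a : F) (x y : T),
    br (upd u i (a *: x + y)) = a *: br (upd u i x) + br (upd u i y).

Record color_algebra (F : fieldType) (G : zmodType) (n : nat) (T : lmodType F)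
    (T_ : G -> {pred T}) (br : {ffun 'I_n -> T} -> T) : Prop := {
  color_graded : graded T_;
  color_multilinear : multilinear br;
  color_homogeneous : forall (theta : 'I_n -> G) (u : {ffun 'I_n -> T}),
    (forall i, u i \in T_ (theta i)) -> br u \in T_ (\sum_i theta i)
}.

(* Nonassociative words in the variables x_i, i : 'I_m, built with an n-ary   *)
(* bracket.                                                                   *)
Inductive word (n m : nat) : Type :=
  | Var of 'I_m
  | Bracket of {ffun 'I_n -> word n m}.
Arguments Var {n m} _.
Arguments Bracket {n m} _.

HB.instance Definition _ (n m : nat) := gen_eqMixin (word n m).
HB.instance Definition _ (n m : nat) := gen_choiceMixin (word n m).

Fixpoint letters (n m : nat) (w : word n m) : seq 'I_m :=
  match w with
  | Var i => [:: i]
  | Bracket ws => flatten [seq letters (ws i) | i <- enum 'I_n]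
  end.

Fixpoint eval_word (F : fieldType) (n m : nat) (T : lmodType F)
    (br : {ffun 'I_n -> T} -> T) (x : 'I_m -> T) (w : word n m) : T :=
  match w with
  | Var i => x i
  | Bracket ws => br [ffun i => eval_word br x (ws i)]
  end.

(* A multilinear polynomial carries the order of variables used to build its  *)
(* color polynomial: it may be that of any word occurring in it.  (If the     *)
(* polynomial is 0 there is no such word, and the order plays no role.)       *)
Record mlpoly (F : fieldType) (n : nat) := MLPoly {
  nvars : nat;
  mlsum : {freeg (word n nvars) / F};
  fixed_order : seq 'I_nvars;
  mlsum_multilinear : forall w, w \in dom mlsum ->
    perm_eq (letters w) (enum 'I_nvars);
  fixed_order_occurs : mlsum != 0 ->
    exists2 w, w \in dom mlsum & letters w = fixed_order
}.

(* The factor eps_sigma from the order r to the order s, the variable x_i     *)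
(* having degree theta i: the product over the pairs (x_a, x_b) such that x_a *)
(* precedes x_b in r and x_b precedes x_a in s.                               *)
Definition color_factor (F : fieldType) (G : zmodType) (eps : G -> G -> F)
    (m : nat) (theta : 'I_m -> G) (r s : seq 'I_m) : F :=
  \prod_(p : 'I_m * 'I_m |
      (index p.1 r < index p.2 r)%N && (index p.2 s < index p.1 s)%N)
    eps (theta p.1) (theta p.2).

Definition color_poly (F : fieldType) (G : zmodType) (eps : G -> G -> F)
    (n : nat) (f : mlpoly F n) (theta : 'I_(nvars f) -> G)
  : {freeg (word n (nvars f)) / F} :=
  \sum_(w <- dom (mlsum f))
    << (coeff w (mlsum f)
        * color_factor eps theta (fixed_order f) (letters w)) *g w >>.

Definition color_identity (F : fieldType) (G : zmodType) (eps : G -> G -> F)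
    (n : nat) (T : lmodType F) (T_ : G -> {pred T})
    (br : {ffun 'I_n -> T} -> T) (f : mlpoly F n) : Prop :=
  forall (theta : 'I_(nvars f) -> G) (x : 'I_(nvars f) -> T),
    (forall i, x i \in T_ (theta i)) ->
    fglift (eval_word br x) (color_poly eps theta) = 0.

Definition color_Omega_algebra (F : fieldType) (G : zmodType)
    (eps : G -> G -> F) (n : nat) (I : Type) (Omega : I -> mlpoly F n)
    (T : lmodType F) (T_ : G -> {pred T}) (br : {ffun 'I_n -> T} -> T) : Prop :=
  color_algebra T_ br /\ forall i, color_identity eps T_ br (Omega i).

Structure tensor_product (F : fieldType) (U V : lmodType F) := TensorProduct {
  tens_sort :> lmodType F;
  tens : {bilinear U -> V -> tens_sort};
  tens_universal : forall (W : lmodType F) (f : {bilinear U -> V -> W}),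
    exists g : {linear tens_sort -> W},
      (forall x a, g (tens x a) = f x a) /\
      (forall g' : {linear tens_sort -> W},
        (forall x a, g' (tens x a) = f x a) -> g' =1 g)
}.

Notation "x *t a" := (tens _ x a) (at level 40, no associativity) : ring_scope.

(* F[t]/(t^(n+1)); the class of t is 'qX.                                     *)
Notation truncpoly F n := {poly %/ ('X^(n.+1) : {poly F})}.

Section Breve.
Variables (F : fieldType) (n : nat) (T : lmodType F).
Variable TA : tensor_product T (truncpoly F n).

Definition breve_pred : {pred TA} := [pred w : TA | `[< exists s : seq (T * T),
  w = \sum_(p <- s) (p.1 *t 'qX + p.2 *t ('qX ^+ n)) >]].

Fact breve_submod_closed : submod_closed breve_pred.
Proof.
split=> [|a u v]; first by apply/asboolP; exists [::]; rewrite big_nil.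
move=> /asboolP[s ->] /asboolP[s' ->]; apply/asboolP.
exists ([seq (a *: p.1, a *: p.2) | p <- s] ++ s').
rewrite big_cat big_map /= scaler_sumr; congr (_ + _).
by apply: eq_bigr => p _; rewrite !linearZl_LR scalerDr.
Qed.

HB.instance Definition _ :=
  GRing.isSubmodClosed.Build F TA breve_pred breve_submod_closed.

Record breve : predArgType :=
  Breve { breve_val :> TA; _ : breve_val \in breve_pred }.

HB.instance Definition _ := [isSub for breve_val].
HB.instance Definition _ := [Choice of breve by <:].
HB.instance Definition _ := [SubChoice_isSubLmodule of breve by <:].

Definition breve_grade (G : zmodType) (T_ : G -> {pred T}) (g : G)
  : {pred breve} :=
  [pred w : breve | `[< exists x y, [/\ x \in T_ g, y \in T_ g
    & val w = x *t 'qX + y *t ('qX ^+ n)] >]].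

(* It suffices to give the bracket on the generators x (x) t^i, i = 1 or n.   *)
Definition breve_bracket_spec (br : {ffun 'I_n -> T} -> T)
    (brb : {ffun 'I_n -> breve} -> breve) : Prop :=
  forall (x : {ffun 'I_n -> T}) (i : 'I_n -> nat) (u : {ffun 'I_n -> breve}),
    (forall j, i j = 1%N \/ i j = n) ->
    (forall j, val (u j) = x j *t ('qX ^+ i j)) ->
    val (brb u) = br x *t ('qX ^+ (\sum_j i j)%N).

End Breve.
Arguments breve_grade {F n T} TA {G} T_ g.

(* Tensor products with F[t]/(t^(n+1)) exist: T[t]/(t^(n+1)), an element      *)
(* being given by its n+1 coefficients, is one.                               *)
Section TruncPolyTensor.
Variables (F : fieldType) (n : nat) (T : lmodType F).

Definition trunc_tens (x : T) (p : truncpoly F n) : {ffun 'I_n.+1 -> T} :=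
  [ffun i : 'I_n.+1 => (p : {poly F})`_i *: x].

Fact trunc_tens_bilinear : bilinear_for *:%R *:%R trunc_tens.
Proof.
split=> [p|x] a u v; apply/ffunP=> i; rewrite !ffunE /=.
  by rewrite scalerDr !scalerA mulrC.
by rewrite coefD coefZ scalerDl scalerA.
Qed.

HB.instance Definition _ := bilinear_isBilinear.Build F T (truncpoly F n)
  {ffun 'I_n.+1 -> T} *:%R *:%R trunc_tens trunc_tens_bilinear.

Let mkE : mk_monic 'X^(n.+1) = 'X^(n.+1) :> {poly F}.
Proof. exact: mk_monic_Xn. Qed.

Fact truncpoly_expand (p : truncpoly F n) :
  p = \sum_(i < n.+1) (p : {poly F})`_i *: 'qX ^+ i.
Proof.
have hs : (size (p : {poly F}) <= n.+1)%N.
  by apply: leq_trans (size_npoly p) _; rewrite mkE size_polyXn.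
have -> : \sum_(i < n.+1) (p : {poly F})`_i *: ('qX : truncpoly F n) ^+ i
   = in_qpoly _ (\sum_(i < n.+1) (p : {poly F})`_i *: 'X^i).
  rewrite linear_sum; apply: eq_bigr => i _.
  by rewrite linearZ /qpolyX -rmorphXn.
apply: val_inj; apply: etrans (esym (in_qpoly_small _)).
  rewrite -poly_def; apply/polyP=> i; rewrite coef_poly.
  by case: ltnP => // /(leq_trans hs) h; rewrite nth_default.
rewrite -poly_def; apply: leq_ltn_trans (size_poly _ _) _.
by rewrite mkE size_polyXn.
Qed.

Fact coef_qXn (i j : 'I_n.+1) :
  (('qX ^+ i : truncpoly F n) : {poly F})`_j = (j == i)%:R.
Proof.
rewrite /qpolyX -rmorphXn in_qpoly_small ?coefXn //.
by rewrite mkE !size_polyXn ltnS.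
Qed.

Fact trunc_tens_universal (W : lmodType F)
    (f : {bilinear T -> (truncpoly F n) -> W}) :
  exists g : {linear {ffun 'I_n.+1 -> T} -> W},
      (forall x a, g (trunc_tens x a) = f x a) /\
      (forall g' : {linear {ffun 'I_n.+1 -> T} -> W},
        (forall x a, g' (trunc_tens x a) = f x a) -> g' =1 g).
Proof.
pose h (v : {ffun 'I_n.+1 -> T}) : W := \sum_(i < n.+1) f (v i) ('qX ^+ i).
have hlin : linear h.
  move=> a u v; rewrite /h scaler_sumr -big_split /=.
  by apply: eq_bigr => i _; rewrite !ffunE linearPl.
pose hL := GRing.isLinear.Build F _ _ _ h hlin.
pose g : {linear {ffun 'I_n.+1 -> T} -> W} := HB.pack h hL.
exists g; split=> [x a|g' g'E v].
  rewrite [in RHS](truncpoly_expand a) /= /h linear_sumr.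
  by apply: eq_bigr => i _; rewrite ffunE linearZl_LR linearZr_LR.
have {1}-> : v = \sum_(i < n.+1) trunc_tens (v i) ('qX ^+ i).
  apply/ffunP=> j; rewrite sum_ffunE (bigD1 j) //= big1 ?addr0 => [|i ij].
    by rewrite ffunE coef_qXn eqxx scale1r.
  by rewrite ffunE coef_qXn eq_sym (negPf ij) scale0r.
by rewrite linear_sum; apply: eq_bigr => i _; exact: g'E.
Qed.

Definition truncpoly_tensor : tensor_product T (truncpoly F n) :=
  @TensorProduct F T (truncpoly F n) {ffun 'I_n.+1 -> T} trunc_tens
    trunc_tens_universal.

End TruncPolyTensor.

(* Main.v *)
Require Import Defs.
From HB Require Import structures.
From mathcomp Require Import all_boot all_order all_algebra.
From mathcomp Require Import boolp freeg.
From mathcomp Require Import sesquilinear.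

(** Every element of the space generated by the x (x) t and y (x) t^n is
    uniquely x (x) t + y (x) t^n; write x and y for its two coordinates
    ([coord1], [coordn]).  When such elements are multiplied, the only product
    of n powers t^(i_j), with i_j = 1 or n, that survives modulo t^(n+1) is
    t * ... * t = t^n: as n >= 2, a single factor t^n already pushes the
    exponent to at least 2n-1 > n.  So the bracket must be
      [w_1, ..., w_n] = [x_1, ..., x_n] (x) t^n,
    where x_j is the t-coordinate of w_j, and this is how it is defined
    ([breve_bracket]).  It is multilinear and homogeneous because the bracket
    of T is, and it is determined by its values on generators
    ([breve_bracket_unique]).

    A product has t-coordinate 0, hence a product with a product among its
    arguments vanishes.  The value of a word therefore depends only on its
    number of letters ([eval_word_breve]): one letter gives both coordinates of
    a variable; n letters are a single bracket and give the value in T, in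
    degree n; every other word gives 0.  All words of a multilinear polynomial
    have the same number of letters, so the value of its color polynomial has as
    coordinates scalar multiples of values of the same color polynomial in T, at
    the t-coordinates and at the t^n-coordinates of the arguments.  These
    coordinates are homogeneous of the degrees of the arguments, so the color
    factors agree, and the values vanish by hypothesis
    ([breve_color_identity]). *)

Set Implicit Arguments.
Unset Strict Implicit.
Unset Printing Implicit Defensive.
Import GRing.Theory.
Local Open Scope ring_scope.

(** * Multilinear maps *)

Section Multilinear.
Variables (F : fieldType) (n : nat).

Lemma upd_id (X : Type) (u : {ffun 'I_n -> X}) i : upd u i (u i) = u.
Proof. by apply/ffunP=> j; rewrite ffunE; case: eqP => [->|]. Qed.

Lemma upd_comp (X Y : Type) (f : X -> Y) (u : {ffun 'I_n -> X}) i x :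
  [ffun j => f (upd u i x j)] = upd [ffun j => f (u j)] i (f x).
Proof. by apply/ffunP=> j; rewrite !ffunE; case: ifP. Qed.

Variable V : lmodType F.

Lemma multilinear_eq0 (b : {ffun 'I_n -> V} -> V) (u : {ffun 'I_n -> V}) i :
  multilinear b -> u i = 0 -> b u = 0.
Proof.
move=> b_ml ui0; rewrite -(upd_id u i) ui0.
have := b_ml u i (-1) 0 0.
by rewrite scaler0 addr0 scaleN1r addNr.
Qed.

(** By induction on a list of positions that may hold an arbitrary vector, each
    position being split into two generators in turn. *)
Lemma multilinear_eq (P : V -> Prop) (b b' : {ffun 'I_n -> V} -> V) :
    (forall v, exists v1 v2, [/\ P v1, P v2 & v = v1 + v2]) ->
    multilinear b -> multilinear b' ->
    (forall u : {ffun 'I_n -> V}, (forall j, P (u j)) -> b u = b' u) ->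
  b =1 b'.
Proof.
move=> spanP b_ml b'_ml eq_bP.
have eq_b (s : seq 'I_n) (u : {ffun 'I_n -> V}) :
    (forall j, j \notin s -> P (u j)) -> b u = b' u.
  elim: s u => [|i s IHs] u Pu; first by apply: eq_bP => j; apply: Pu.
  have [v1 [v2 [Pv1 Pv2 ui]]] := spanP (u i).
  rewrite -(upd_id u i) ui -[v1]scale1r b_ml b'_ml.
  congr (_ *: _ + _); apply: IHs => j js; rewrite ffunE;
    by case: eqP => // /eqP ji; apply: Pu; rewrite inE negb_or ji.
by move=> u; apply: (eq_b (enum 'I_n)) => j; rewrite mem_enum.
Qed.

End Multilinear.

(** Turns a sum over a list with repetitions into one over a chosen
    duplicate-free list, so that two homogeneous decompositions can be indexed
    by the same degrees. *)
Lemma sum_mulrn_count (V : zmodType) (I : eqType) (s S : seq I) (c : I -> V) :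
  uniq S -> {subset s <= S} ->
  \sum_(i <- s) c i = \sum_(i <- S) c i *+ count_mem i s.
Proof.
move=> S_uniq; elim: s => [|j s IHs] sub_sS.
  by rewrite big_nil big1_seq.
rewrite big_cons IHs => [|i si]; last by apply: sub_sS; rewrite inE si orbT.
rewrite [RHS](eq_bigr (fun i => c i *+ (j == i) + c i *+ count_mem i s)).
  rewrite big_split /=; congr (_ + _).
  rewrite (bigD1_seq j) ?sub_sS ?mem_head //= eqxx big1 ?addr0 // => i ij.
  by rewrite eq_sym (negPf ij).
by move=> i _; rewrite -mulrnDr.
Qed.

(** * Words and color polynomials *)

(** The induction principle generated with the type of words gives no hypothesis
    on the words under a bracket. *)
Lemma word_nested_ind (n m : nat) (P : word n m -> Prop) :
    (forall i, P (Var i)) ->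
    (forall ws : {ffun 'I_n -> word n m}, (forall i, P (ws i)) ->
      P (Bracket ws)) ->
  forall w, P w.
Proof.
move=> PVar PBracket; fix IHw 1 => -[i|ws]; first exact: PVar.
by apply: PBracket => i; apply: IHw.
Qed.

Section Letters.
Variables (n m : nat).

Lemma size_letters_Bracket (ws : {ffun 'I_n -> word n m}) :
  size (letters (Bracket ws)) = (\sum_i size (letters (ws i)))%N.
Proof.
by rewrite /= size_flatten /shape -map_comp sumnE big_map big_enum.
Qed.

Hypothesis n_gt1 : (1 < n)%N.

Lemma size_letters_gt0 (w : word n m) : (0 < size (letters w))%N.
Proof.
elim/word_nested_ind: w => // ws ws_gt0.
rewrite size_letters_Bracket (bigD1 (Ordinal (ltnW n_gt1))) //=.
by rewrite ltn_addr.
Qed.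

Lemma leq_size_letters_Bracket (ws : {ffun 'I_n -> word n m}) :
  (n <= size (letters (Bracket ws)))%N.
Proof.
rewrite size_letters_Bracket -[leqLHS]card_ord -sum1_card leq_sum // => i _.
exact: size_letters_gt0.
Qed.

Lemma size_letters_eq1 (w : word n m) :
  size (letters w) = 1%N -> exists i, w = Var i.
Proof.
case: w => [i|ws]; first by exists i.
by move=> sz; have := leq_size_letters_Bracket ws; rewrite sz leqNgt n_gt1.
Qed.

(** The equality case of [leq_size_letters_Bracket]. *)
Lemma size_letters_eqn (ws : {ffun 'I_n -> word n m}) :
  (size (letters (Bracket ws)) == n) = [forall i, size (letters (ws i)) == 1%N].
Proof.
rewrite size_letters_Bracket.
have letters_leqif i : true -> (1 <= size (letters (ws i))
    ?= iff (size (letters (ws i)) == 1))%N.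
  by rewrite eq_sym; split => //; apply: size_letters_gt0.
have [_] := leqif_sum letters_leqif.
by rewrite sum1_card card_ord eq_sym => ->.
Qed.

End Letters.

Lemma fglift_color_poly (F : fieldType) (G : zmodType) (eps : G -> G -> F)
    (n : nat) (f : mlpoly F n) (theta : 'I_(nvars f) -> G) (M : lmodType F)
    (e : word n (nvars f) -> M) :
  fglift e (color_poly eps theta) =
  \sum_(w <- dom (mlsum f))
    (coeff w (mlsum f) * color_factor eps theta (fixed_order f) (letters w))
      *: e w.
Proof.
pose liftA := GRing.isZmodMorphism.Build _ _ (fglift e) (lift_is_additive e).
pose lift : {additive _ -> _} := HB.pack (fglift e) liftA.
rewrite /color_poly -[fglift e _]/(lift _) raddf_sum /=.
by apply: eq_bigr => w _; rewrite liftU.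
Qed.

(** * Coordinates in a tensor product with truncated polynomials *)

Lemma truncpolyXn_eq0 (F : fieldType) (n k : nat) : (n < k)%N ->
  ('qX : truncpoly F n) ^+ k = 0.
Proof.
move=> lt_nk; rewrite /qpolyX -rmorphXn /=; apply: val_inj => /=.
rewrite mk_monic_Xn -(subnK lt_nk) exprD.
by rewrite Pdiv.RingMonic.rmodp_mull ?monicXn.
Qed.

Section TensCoord.
Variables (F : fieldType) (n : nat) (T : lmodType F).
Variable TA : tensor_product T (truncpoly F n).

(** The comparison of an arbitrary tensor product with the model by lists of
    n+1 coefficients; it is what makes coordinates available, as TA is only
    known through its universal property. *)
Definition tens_coords : {linear TA -> {ffun 'I_n.+1 -> T}} :=
  sval (cid (tens_universal TA (trunc_tens (n := n) (T := T)))).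

Lemma tens_coordsE x p : tens_coords (x *t p) = trunc_tens x p.
Proof. by rewrite /tens_coords; case: cid => g []. Qed.

Definition tens_coord (i : 'I_n.+1) (w : TA) : T := tens_coords w i.

Fact tens_coord_linear i : linear (tens_coord i).
Proof. by move=> a u v; rewrite /tens_coord linearP !ffunE. Qed.

HB.instance Definition _ i :=
  GRing.isLinear.Build F TA T _ (tens_coord i) (tens_coord_linear i).

Lemma tens_coord_tensXn i x k : (k <= n)%N ->
  tens_coord i (x *t 'qX ^+ k) = (i == k :> nat)%:R *: x.
Proof.
move=> le_kn; rewrite /tens_coord tens_coordsE ffunE.
by rewrite (coef_qXn F (Ordinal (le_kn : (k < n.+1)%N)) i).
Qed.

End TensCoord.

(** * The algebra on T (x) t + T (x) t^n *)

Section Breve.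
Variables (F : fieldType) (n : nat) (T : lmodType F).
Variable TA : tensor_product T (truncpoly F n).
Hypothesis n_gt1 : (1 < n)%N.

Let ord1 : 'I_n.+1 := Ordinal (ltnW n_gt1 : (1 < n.+1)%N).

Definition coord1 (w : breve TA) : T := tens_coord ord1 (val w).
Definition coordn (w : breve TA) : T := tens_coord ord_max (val w).

Fact coord1_linear : linear coord1.
Proof. by move=> a u v; rewrite /coord1 !linearP. Qed.

Fact coordn_linear : linear coordn.
Proof. by move=> a u v; rewrite /coordn !linearP. Qed.

HB.instance Definition _ :=
  GRing.isLinear.Build F (breve TA) T _ coord1 coord1_linear.
HB.instance Definition _ :=
  GRing.isLinear.Build F (breve TA) T _ coordn coordn_linear.

Fact breve_pair_subproof (x y : T) :
  x *t 'qX + y *t ('qX ^+ n) \in breve_pred (TA := TA).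
Proof. by apply/asboolP; exists [:: (x, y)]; rewrite big_seq1. Qed.

Definition breve_pair (x y : T) : breve TA := Breve (breve_pair_subproof x y).

(** The exponent 1 is kept so that both terms have the shape required by the
    lemmas on powers of t. *)
Lemma breve_pairE x y :
  val (breve_pair x y) = x *t ('qX ^+ 1) + y *t ('qX ^+ n).
Proof. by []. Qed.

Lemma breve_pair_linear a x y x' y' :
  breve_pair (a *: x + x') (a *: y + y') =
  a *: breve_pair x y + breve_pair x' y'.
Proof.
apply: val_inj; rewrite linearP /= !linearPl scalerDr.
by rewrite addrACA.
Qed.

Lemma coord1_tensXn (w : breve TA) x k : (k <= n)%N ->
  val w = x *t 'qX ^+ k -> coord1 w = (k == 1)%N%:R *: x.
Proof. by move=> le_kn wE; rewrite /coord1 wE tens_coord_tensXn // eq_sym. Qed.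

Lemma coord1_pair x y : coord1 (breve_pair x y) = x.
Proof.
rewrite /coord1 breve_pairE linearD /= !tens_coord_tensXn ?(ltnW n_gt1) //=.
by rewrite scale1r (ltn_eqF n_gt1) scale0r addr0.
Qed.

Lemma coordn_pair x y : coordn (breve_pair x y) = y.
Proof.
rewrite /coordn breve_pairE linearD /= !tens_coord_tensXn ?(ltnW n_gt1) //=.
by rewrite eqxx scale1r (gtn_eqF n_gt1) scale0r add0r.
Qed.

Lemma breve_pair_coords (w : breve TA) : breve_pair (coord1 w) (coordn w) = w.
Proof.
have [s ws] : exists s : seq (T * T),
    val w = \sum_(p <- s) (p.1 *t 'qX + p.2 *t ('qX ^+ n)).
  by have /asboolP := valP w.
suff -> : w = breve_pair (\sum_(p <- s) p.1) (\sum_(p <- s) p.2).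
  by rewrite coord1_pair coordn_pair.
apply: val_inj; rewrite ws breve_pairE.
by rewrite !linear_sumlz big_split.
Qed.

Lemma coords_inj (v w : breve TA) :
  coord1 v = coord1 w -> coordn v = coordn w -> v = w.
Proof.
by move=> v1 vn; rewrite -(breve_pair_coords v) v1 vn breve_pair_coords.
Qed.

Section Grading.
Variables (G : zmodType) (T_ : G -> {pred T}).

Lemma mem_breve_grade g (w : breve TA) :
  (w \in breve_grade TA T_ g) = (coord1 w \in T_ g) && (coordn w \in T_ g).
Proof.
apply/asboolP/andP => [[x [y [xg yg wE]]]|[xg yg]].
  have -> : w = breve_pair x y by apply: val_inj.
  by rewrite coord1_pair coordn_pair.
by exists (coord1 w), (coordn w); split=> //; rewrite -{1}(breve_pair_coords w).
Qed.

(** Through the two coordinates this is the direct sum of two copies of the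
    graded space T, hence graded. *)
Lemma breve_graded : graded T_ -> graded (breve_grade TA T_).
Proof.
case=> T_submod T_span T_free.
split=> [g|w|s c s_uniq c_homog sum0 g gs].
- have [T0 TP] := T_submod g.
  split=> [|a u v]; rewrite !mem_breve_grade; first by rewrite !linear0 T0.
  by move=> /andP[u1 un] /andP[v1 vn]; rewrite !linearP !TP.
- have [s [c [c_homog cE]]] := T_span (coord1 w).
  have [s' [c' [c'_homog c'E]]] := T_span (coordn w).
  have T_muln g k x : x \in T_ g -> x *+ k \in T_ g.
    have [T0 TP] := T_submod g.
    move=> xg; elim: k => [|k IHk]; first by rewrite mulr0n.
    by rewrite mulrS -[x in x + _]scale1r TP.
  (* s and s' may differ or repeat a degree, whereas one list of degrees has to
     serve both coordinates: multiplicities are moved into the components. *)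
  exists (undup (s ++ s')), (fun g =>
    breve_pair (c g *+ count_mem g s) (c' g *+ count_mem g s')).
  split=> [g|].
    by rewrite mem_breve_grade coord1_pair coordn_pair !T_muln.
  apply: coords_inj; rewrite linear_sum /=.
    under eq_bigr do rewrite coord1_pair.
    rewrite cE; apply: sum_mulrn_count (undup_uniq _) _ => g gs.
    by rewrite mem_undup mem_cat gs.
  under eq_bigr do rewrite coordn_pair.
  rewrite c'E; apply: sum_mulrn_count (undup_uniq _) _ => g gs.
  by rewrite mem_undup mem_cat gs orbT.
- apply: coords_inj; rewrite linear0.
    apply: (T_free s (coord1 \o c)) => // [h|].
      by have := c_homog h; rewrite mem_breve_grade => /andP[].
    by rewrite -linear_sum sum0 linear0.
  apply: (T_free s (coordn \o c)) => // [h|].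
    by have := c_homog h; rewrite mem_breve_grade => /andP[].
  by rewrite -linear_sum sum0 linear0.
Qed.

End Grading.

Variable br : {ffun 'I_n -> T} -> T.

Definition breve_bracket (u : {ffun 'I_n -> breve TA}) : breve TA :=
  breve_pair 0 (br [ffun i => coord1 (u i)]).

Lemma breve_bracket_multilinear : multilinear br -> multilinear breve_bracket.
Proof.
move=> br_ml u i a v w; rewrite /breve_bracket !upd_comp linearP br_ml.
by rewrite -breve_pair_linear scaler0 addr0.
Qed.

(** If some factor is x_j (x) t^n, the left side vanishes because that factor
    has t-coordinate 0, and the right side because the total exponent
    exceeds n. *)
Lemma breve_bracketP : multilinear br -> breve_bracket_spec br breve_bracket.
Proof.
move=> br_ml x i u i1n uE; rewrite breve_pairE linear0l add0r.
have coord1_u j : coord1 (u j) = (i j == 1)%N%:R *: x j.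
  by apply: coord1_tensXn (uE j); case: (i1n j) => ->; rewrite ?(ltnW n_gt1).
have [/forallP i1|/forallPn[j ij_neq1]] := boolP [forall j, i j == 1%N].
  have -> : (\sum_j i j)%N = n.
    by rewrite (eq_bigr (fun=> 1%N)) ?sum1_card ?card_ord // => j _; apply/eqP.
  congr (br _ *t _); apply/ffunP=> j.
  by rewrite ffunE coord1_u i1 scale1r.
have i_gt0 k : (0 < i k)%N by case: (i1n k) => ->; rewrite ?(ltnW n_gt1).
have ij : i j = n by case: (i1n j) ij_neq1 => ->.
rewrite (multilinear_eq0 (i := j) br_ml) ?ffunE; last first.
  by rewrite coord1_u (negPf ij_neq1) scale0r.
suff lt_n : (n < \sum_j i j)%N.
  by rewrite linear0l (truncpolyXn_eq0 _ lt_n) linear0r.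
have [k kj] : exists k : 'I_n, k != j.
  have [->|] := eqVneq j (Ordinal n_gt1).
    by exists (Ordinal (ltnW n_gt1)).
  by rewrite eq_sym; exists (Ordinal n_gt1).
rewrite (bigD1 j) //= ij (bigD1 k) //=.
by rewrite addnA ltn_addr // -ltn_subLR // subnn.
Qed.

Lemma breve_bracket_unique (brb : {ffun 'I_n -> breve TA} -> breve TA) :
  multilinear br -> multilinear brb -> breve_bracket_spec br brb ->
  brb =1 breve_bracket.
Proof.
move=> br_ml brb_ml brbP.
pose gen (w : breve TA) :=
  exists x k, (k = 1%N \/ k = n) /\ val w = x *t 'qX ^+ k.
apply: (multilinear_eq (P := gen)) => // [w||u gen_u].
- exists (breve_pair (coord1 w) 0), (breve_pair 0 (coordn w)); split.
  + by exists (coord1 w), 1%N; split; [left|rewrite breve_pairE linear0l addr0].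
  + by exists (coordn w), n; split; [right|rewrite breve_pairE linear0l add0r].
  + rewrite -[breve_pair _ 0]scale1r -breve_pair_linear.
    by rewrite scaler0 add0r scale1r addr0 breve_pair_coords.
- exact: breve_bracket_multilinear.
have /choice[x /choice[k xkP]] := gen_u.
have k1n j : k j = 1%N \/ k j = n by have [] := xkP j.
have uE j : val (u j) = finfun x j *t 'qX ^+ k j.
  by have [] := xkP j; rewrite ffunE.
by apply: val_inj; rewrite (brbP _ _ _ k1n uE) (breve_bracketP br_ml k1n uE).
Qed.

Lemma eval_word_breve (m : nat) (x : 'I_m -> breve TA) (w : word n m) :
    multilinear br ->
  eval_word breve_bracket x w =
    breve_pair
      ((size (letters w) == 1)%N%:R *: eval_word br (coord1 \o x) w)
      ((size (letters w) == 1)%N%:R *: eval_word br (coordn \o x) w +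
       (size (letters w) == n)%:R *: eval_word br (coord1 \o x) w).
Proof.
move=> br_ml; case: w => [i|ws].
  rewrite /= !scale1r (ltn_eqF n_gt1) scale0r addr0.
  by rewrite breve_pair_coords.
rewrite [eval_word breve_bracket _ _]/=.
rewrite gtn_eqF ?(leq_trans n_gt1 (leq_size_letters_Bracket n_gt1 ws)) //.
rewrite !scale0r add0r size_letters_eqn //; congr breve_pair.
have [/forallP flat|/forallPn[i nested]] :=
    boolP [forall i, size (letters (ws i)) == 1%N].
  rewrite scale1r; congr br; apply/ffunP=> i; rewrite !ffunE.
  by have [j ->] := size_letters_eq1 n_gt1 (eqP (flat i)).
(* The argument in position i is itself a product: its t-coordinate is 0. *)
rewrite scale0r; apply: (multilinear_eq0 (i := i)) => //; rewrite !ffunE.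
by case: (ws i) nested => // ws' _; rewrite coord1_pair.
Qed.

Lemma breve_color_identity (G : zmodType) (eps : G -> G -> F)
    (T_ : G -> {pred T}) (f : mlpoly F n) :
  multilinear br -> color_identity eps T_ br f ->
  color_identity eps (breve_grade TA T_) breve_bracket f.
Proof.
move=> br_ml f_id theta x x_homog.
pose m := nvars f.
pose k w := coeff w (mlsum f)
  * color_factor eps theta (fixed_order f) (letters w).
have f_sum0 (y : 'I_m -> T) : (forall i, y i \in T_ (theta i)) ->
    \sum_(w <- dom (mlsum f)) k w *: eval_word br y w = 0.
  by move=> y_homog; rewrite -fglift_color_poly f_id.
have sum1 : \sum_(w <- dom (mlsum f)) k w *: eval_word br (coord1 \o x) w = 0.
  by apply: f_sum0 => i; have := x_homog i; rewrite mem_breve_grade => /andP[].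
have sumn : \sum_(w <- dom (mlsum f)) k w *: eval_word br (coordn \o x) w = 0.
  by apply: f_sum0 => i; have := x_homog i; rewrite mem_breve_grade => /andP[].
(* Every word of f has exactly m letters, so the Boolean factors below do not
   depend on w and come out of the sum. *)
have evalE w : w \in dom (mlsum f) ->
    k w *: eval_word breve_bracket x w = breve_pair
      ((m == 1)%N%:R *: (k w *: eval_word br (coord1 \o x) w))
      ((m == 1)%N%:R *: (k w *: eval_word br (coordn \o x) w) +
       (m == n)%:R *: (k w *: eval_word br (coord1 \o x) w)).
  move=> /mlsum_multilinear/perm_size; rewrite size_enum_ord => w_size.
  rewrite eval_word_breve // w_size -[LHS]addr0.
  have -> : 0 = breve_pair 0 0.
    by apply: val_inj; rewrite breve_pairE !linear0l addr0.
  rewrite -breve_pair_linear !addr0 scalerDr.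
  by congr (breve_pair _ (_ + _)); rewrite !scalerA mulrC.
rewrite fglift_color_poly (eq_big_seq _ evalE).
apply: coords_inj; rewrite linear_sum linear0 /=.
  under eq_bigr do rewrite coord1_pair.
  by rewrite -scaler_sumr sum1 scaler0.
under eq_bigr do rewrite coordn_pair.
by rewrite big_split /= -!scaler_sumr sum1 sumn !scaler0 addr0.
Qed.

End Breve.

Theorem proposition3p3 (F : fieldType) (G : zmodType) (eps : G -> G -> F)
    (heps : bicharacter eps)
    (n : nat) (hn : (2 <= n)%N)
    (I : Type) (Omega : I -> mlpoly F n)
    (T : lmodType F) (T_ : G -> {pred T}) (br : {ffun 'I_n -> T} -> T)
    (hT : color_Omega_algebra eps Omega T_ br)
    (TA : tensor_product T (truncpoly F n)) :
  exists brb : {ffun 'I_n -> breve TA} -> breve TA,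
    [/\ breve_bracket_spec br brb,
        color_Omega_algebra eps Omega (breve_grade TA T_) brb
      & forall brb' : {ffun 'I_n -> breve TA} -> breve TA,
          multilinear brb' -> breve_bracket_spec br brb' -> brb' =1 brb].
Proof.
have [[T_graded br_ml br_homog] T_ids] := hT.
exists (breve_bracket hn br); split.
- exact: breve_bracketP.
- split; last by move=> i; apply: breve_color_identity (T_ids i).
  split; first exact: breve_graded hn _ _ T_graded.
    exact: breve_bracket_multilinear.
  move=> theta u u_homog; rewrite (mem_breve_grade hn) coord1_pair.
  rewrite (coordn_pair TA hn).
  have [T0 _] := graded_submod T_graded (\sum_i theta i).
  rewrite T0 br_homog // => i.
  by have := u_homog i; rewrite (mem_breve_grade hn) ffunE => /andP[].
- by move=> brb' brb'_ml brb'P; apply: breve_bracket_unique.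
Qed.
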